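(* For every integer $n\ge 2$ there is an isomorphism of $\psi$-rings $$\widehat{K}(I\mathbb{P}(1,n))_{\mathbb{C}}\;\cong\;K(Z_n)_{\mathbb{C}},$$ where the virtual augmentation completion $\widehat{K}(I\mathbb{P}(1,n))_{\mathbb{C}}$ carries the virtual product and the virtual Adams operations, and $K(Z_n)_{\mathbb{C}}$, the K-theory (with complex coefficients) of the toric crepant resolution $Z_n$ of the cotangent bundle of $\mathbb{P}(1,n)$, carries the ordinary product and the ordinary Adams operations.
   Context: **$\psi$-rings.** A $\psi$-ring is a commutative unital ring $R$ with ring homomorphisms $\psi^k:R\to R$, $k\ge1$, such that $\psi^1=\mathrm{id}$ and $\psi^k\circ\psi^j=\psi^{kj}$. An isomorphism of $\psi$-rings is a ring isomorphism commuting with all $\psi^k$. **Virtual K-theory of $\mathbb{P}(1,n)$.** Fix $n\ge2$, $\zeta=\exp(2\pi i/n)$, $G=\mathbb{C}^*$. Let $X=\mathbb{C}^2\setminus\{(0,0)\}$ with the action $\lambda\cdot(z_1,z_2)=(\lambda z_1,\lambda^n z_2)$; $\mathbb{P}(1,n)=[X/G]$. The inertia manifold is $I_GX=\coprod_{m\in\mathbb{Z}/n\mathbb{Z}}X^m$, with $X^m$ the fixed locus of $\zeta^m$, and $K(I\mathbb{P}(1,n))_{\mathbb{C}}=K_G(I_GX)\otimes\mathbb{C}$. As a vector space it is $\bigoplus_{m=0}^{n-1}A_m$ with $$A_0=\frac{\mathbb{C}[x_0^{\pm1}]}{\langle (x_0-1)(x_0^n-1)\rangle},\qquad A_m=\frac{\mathbb{C}[x_m^{\pm1}]}{\langle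 x_m^n-1\rangle}\quad(1\le m\le n-1).$$ The virtual product $*$ is the $\mathbb{C}$-bilinear product with, for $a_1,a_2\in\mathbb{Z}$ and $m_1,m_2\in\{0,\dots,n-1\}$ (index $m_1+m_2$ taken mod $n$), $$x_{m_1}^{a_1}*x_{m_2}^{a_2}=x_{m_1+m_2}^{a_1+a_2}\cdot e(m_1,m_2),$$ where the product on the right is the ordinary one in $A_{m_1+m_2}$ and $e(m_1,m_2)=1$ if $m_1=0$ or $m_2=0$; $e(m_1,m_2)=(1-x_0^{-1})^2$ if $m_1,m_2\ne0$ and $m_1+m_2=n$; $e(m_1,m_2)=1-x_{m_1+m_2}^{-1}$ otherwise. The virtual Adams operations are the $\mathbb{C}$-linear maps $\widetilde\psi^k$ ($k\ge1$) with $\widetilde\psi^k(x_0^a)=x_0^{ka}$ and $\widetilde\psi^k(x_m^a)=x_m^{ka}\cdot\sum_{i=0}^{k-1}x_m^{-i}$ (ordinary product) for $m\ne0$. The virtual augmentation is the $\mathbb{C}$-linear map $\widetilde\epsilon$ with $\widetilde\epsilon(x_0^a)=1_0$ (the identity of $A_0$) and $\widetilde\epsilon(x_m^a)=0$ for $m\neq0$. With these, $K(I\mathbb{P}(1,n))_{\mathbb{C}}$ is an augmented $\psi$-ring, with $\widetilde\epsilon\circ\widetilde\psi^k=\widetilde\psi^k\circ\widetilde\epsilon=\widetilde\epsilon$. **Virtual augmentation completion.** $\widehat{K}(I\mathbb{P}(1,n))_{\mathbb{C}}$ is the completion of the ring $(K(I\mathbb{P}(1,n))_{\mathbb{C}},*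 )$ with respect to the ideal $\ker\widetilde\epsilon$, with the $\psi$-ring structure induced by $\widetilde\psi^k$. **The resolution.** The cotangent bundle of $\mathbb{P}(1,n)$ is the toric quotient stack $[(X\times\mathbb{A}^1)/\mathbb{C}^*]$, with $\mathbb{C}^*$ acting with weights $(1,n,-(n+1))$. It has an associated simplicial fan in $\mathbb{Z}^2$: one may take rays generated by $(-n,1),(1,1),(0,1)$ and maximal cones $\langle(-n,1),(0,1)\rangle$ and $\langle(0,1),(1,1)\rangle$. $Z_n$ is the toric crepant resolution determined by subdividing this fan, i.e. the smooth toric surface with rays generated by $(i,1)$, $-n\le i\le1$, and maximal cones spanned by consecutive rays. Its ordinary K-theory ring (a known result) is $$K(Z_n)_{\mathbb{C}}=\frac{\mathbb{C}[\chi_0^{\pm1},\dots,\chi_{n-1}^{\pm1}]}{\langle(\chi_i-1)(\chi_j-1)\;:\;0\le i,j\le n-1\rangle},$$ where the $\chi_i$ are classes of line bundles, so the ordinary Adams operations (extended $\mathbb{C}$-linearly) satisfy $\psi^k(\chi_i)=\chi_i^k$. *)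

(* Defs.v *)
From HB Require Import structures.
From mathcomp Require Import all_boot all_order all_algebra.
From mathcomp Require Import generic_quotient ring_quotient.
From mathcomp Require Import boolp reals complex.
From mathcomp Require Import finmap ring zify.
From mathcomp.multinomials Require Import monalg.

Set Implicit Arguments.
Unset Strict Implicit.
Unset Printing Implicit Defensive.

Import GRing.Theory.
Local Open Scope ring_scope.
Local Open Scope quotient_scope.

(* [psi 0] is meaningless: only the operations [psi k] with [k > 0] matter. *)
HB.mixin Record isPsiRing R of GRing.ComNzRing R := {
  psi : nat -> R -> R;
  psi_zmod_morphism : forall k, (0 < k)%N -> zmod_morphism (psi k);
  psi_monoid_morphism : forall k, (0 < k)%N -> monoid_morphism (psi k);
  psi1 : forall x, psi 1 x = x;
  psi_comp : forall k j, (0 < k)%N -> (0 < j)%N ->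
    forall x, psi k (psi j x) = psi (k * j) x
}.

#[short(type="psiRingType")]
HB.structure Definition PsiRing := {R of isPsiRing R & GRing.ComNzRing R}.

Definition psi_isomorphic (R S : psiRingType) : Prop :=
  exists f : {rmorphism R -> S},
    bijective f /\ (forall k, (0 < k)%N -> forall x, f (psi k x) = psi k (f x)).

(* The group algebra F[K] of an additive abelian group K.  For K = int it is
   F[x^{+-1}], for K = {ffun 'I_n -> int} it is F[x_0^{+-1},...,x_{n-1}^{+-1}].
   The ring structure that multinomials puts on {malg F[K]} requires a monoid K
   without nontrivial units, so it does not apply here. *)
Section GroupAlgebra.
Variables (F : fieldType) (K : zmodType).

Definition grpalg : Type := {malg F[K]}.

HB.instance Definition _ := Choice.on grpalg.

(* The module operations are those of {malg F[K]}; here and below, locking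
   only prevents costly unfolding. *)
Fact grpalg_key : unit. Proof. exact: tt. Qed.
Definition gzero : grpalg := locked_with grpalg_key (0 : {malg F[K]}).
Definition gopp : grpalg -> grpalg :=
  locked_with grpalg_key (fun g : {malg F[K]} => - g).
Definition gadd : grpalg -> grpalg -> grpalg :=
  locked_with grpalg_key (fun g1 g2 : {malg F[K]} => g1 + g2).
Definition gscale : F -> grpalg -> grpalg :=
  locked_with grpalg_key (fun c (g : {malg F[K]}) => c *: g).
Definition mon (a : K) : grpalg :=
  locked_with grpalg_key (fun a => << 1 *g a >> : {malg F[K]}) a.

Lemma gaddA : associative gadd.
Proof. by rewrite /gadd unlock; exact: addrA. Qed.
Lemma gaddC : commutative gadd.
Proof. by rewrite /gadd unlock; exact: addrC. Qed.
Lemma gadd0 : left_id gzero gadd.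
Proof. by rewrite /gadd /gzero !unlock; exact: add0r. Qed.
Lemma gaddN : left_inverse gzero gopp gadd.
Proof. by rewrite /gadd /gzero /gopp !unlock; exact: addNr. Qed.

HB.instance Definition _ := GRing.isZmodule.Build grpalg
  gaddA gaddC gadd0 gaddN.

Lemma gscaleA a b v : gscale a (gscale b v) = gscale (a * b) v.
Proof. by rewrite /gscale unlock scalerA. Qed.
Lemma gscale1 : left_id 1 gscale.
Proof. by rewrite /gscale unlock; exact: scale1r. Qed.
Lemma gscaleDr : right_distributive gscale +%R.
Proof.
by rewrite /gscale /(+%R) /= /gadd !unlock; exact: scalerDr.
Qed.
Lemma gscaleDl v : {morph gscale^~ v : a b / a + b}.
Proof.
move=> a b; rewrite -[RHS]/(gadd (gscale a v) (gscale b v)).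
by rewrite /gscale /gadd !unlock; exact: scalerDl.
Qed.

HB.instance Definition _ := GRing.Zmodule_isLmodule.Build F grpalg
  gscaleA gscale1 gscaleDr gscaleDl.

Definition gcoef (a : K) (g : grpalg) : F := mcoeff a g.

Lemma gcoefD a g1 g2 : gcoef a (g1 + g2) = gcoef a g1 + gcoef a g2.
Proof. by rewrite -[g1 + g2]/(gadd g1 g2) /gadd unlock /gcoef mcoeffD. Qed.
Lemma gcoefZ a c g : gcoef a (c *: g) = c * gcoef a g.
Proof. by rewrite -[c *: g]/(gscale c g) /gscale unlock /gcoef mcoeffZ. Qed.
Lemma gcoef0 a : gcoef a 0 = 0.
Proof. by rewrite -(scale0r (0 : grpalg)) gcoefZ mul0r. Qed.
Lemma gcoef_mon a b : gcoef a (mon b) = (b == a)%:R.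
Proof. by rewrite /mon unlock /gcoef mcoeffU. Qed.

Lemma gcoefP g1 g2 : (forall a, gcoef a g1 = gcoef a g2) -> g1 = g2.
Proof. by move=> E; apply/malgP. Qed.

(* The linear map taking x^a to h a. *)
Definition linext (V : lmodType F) (h : K -> V) : grpalg -> V :=
  locked_with grpalg_key
    (fun g => \sum_(a <- msupp g) gcoef a g *: h a).

Lemma linextE (V : lmodType F) (h : K -> V) g :
  linext h g = \sum_(a <- msupp g) gcoef a g *: h a.
Proof. by rewrite /linext unlock. Qed.

Lemma linextw (V : lmodType F) (h : K -> V) (g : grpalg) (d : {fset K}) :
  (msupp g `<=` d)%fset -> linext h g = \sum_(a <- d) gcoef a g *: h a.
Proof.
move=> le_gd; rewrite linextE (big_fset_incl _ le_gd) //= => a _ ga.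
by rewrite /gcoef mcoeff_outdom // scale0r.
Qed.

Lemma linext_is_linear (V : lmodType F) (h : K -> V) : linear (linext h).
Proof.
move=> c x y; pose d := (msupp x `|` msupp y `|` msupp (c *: x + y))%fset.
rewrite (@linextw _ h x d) ?(@linextw _ h y d) ?(@linextw _ h _ d) //.
- rewrite scaler_sumr -big_split /=; apply: eq_bigr => a _.
  by rewrite gcoefD gcoefZ scalerDl scalerA.
- by rewrite fsubsetUr.
- by rewrite /d -fsetUA fsubsetU // fsubsetUl orbT.
- by rewrite /d -fsetUA fsubsetUl.
Qed.

HB.instance Definition _ (V : lmodType F) (h : K -> V) :=
  GRing.isLinear.Build F grpalg V _ (linext h) (linext_is_linear h).

Lemma linext_mon (V : lmodType F) (h : K -> V) a : linext h (mon a) = h a.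
Proof.
have le_a : (msupp (mon a) `<=` [fset a])%fset by rewrite /mon unlock msuppU_le.
by rewrite (linextw _ le_a) big_seq_fset1 gcoef_mon eqxx scale1r.
Qed.

Lemma grpalgE (g : grpalg) : g = \sum_(a <- msupp g) gcoef a g *: mon a.
Proof.
apply: gcoefP => b; rewrite (big_morph _ (gcoefD b) (gcoef0 b)).
under eq_bigr => a _ do rewrite gcoefZ gcoef_mon.
have [gb|gb] := boolP (b \in msupp g).
  rewrite (big_fsetD1 b) //= eqxx mulr1 big1_fset ?addr0 // => a.
  by rewrite !inE => /andP[/negbTE -> _] _; rewrite mulr0.
rewrite /gcoef mcoeff_outdom // big1_fset // => a ga _.
by case: eqP gb => [<-|_]; rewrite ?ga ?mulr0.
Qed.

Lemma linear_ext (V : lmodType F) (f1 f2 : grpalg -> V) :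
  linear f1 -> linear f2 -> (forall a, f1 (mon a) = f2 (mon a)) -> f1 =1 f2.
Proof.
move=> l1 l2 eqf g.
pose i1 := GRing.isLinear.Build _ _ _ _ f1 l1.
pose i2 := GRing.isLinear.Build _ _ _ _ f2 l2.
pose h1 : {linear grpalg -> V} := HB.pack f1 i1.
pose h2 : {linear grpalg -> V} := HB.pack f2 i2.
change (h1 g = h2 g); rewrite [g]grpalgE !linear_sum.
by apply: eq_bigr => a _; rewrite !linearZ_LR /= eqf.
Qed.

(* The bilinear product with x^a * x^b = x^(a + b). *)
Definition gmul : grpalg -> grpalg -> grpalg :=
  locked_with grpalg_key (fun g1 g2 =>
    linext (fun a => linext (fun b => mon (a + b)) g2) g1).

Lemma gmulE g1 g2 :
  gmul g1 g2 = linext (fun a => linext (fun b => mon (a + b)) g2) g1.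
Proof. by rewrite /gmul unlock. Qed.

Lemma gmul_mon a b : gmul (mon a) (mon b) = mon (a + b).
Proof. by rewrite gmulE !linext_mon. Qed.

Lemma gmul_linl g2 : linear (gmul^~ g2).
Proof. by move=> c x y; rewrite !gmulE linearP. Qed.

Lemma gmul_linr g1 : linear (gmul g1).
Proof.
move=> c x y; rewrite !gmulE !(linextE _ g1) scaler_sumr -big_split /=.
by apply: eq_bigr => a _; rewrite linearP scalerDr !scalerA mulrC.
Qed.

Lemma gmulC : commutative gmul.
Proof.
move=> x y; move: x; apply: (linear_ext (gmul_linl y) (gmul_linr y)) => a.
move: y; apply: (linear_ext (gmul_linr _) (gmul_linl _)) => b.
by rewrite !gmul_mon addrC.
Qed.

Lemma gmulA : associative gmul.
Proof.
move=> x y z; move: x; apply: linear_ext.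
- exact: gmul_linl.
- by move=> c u v; rewrite !gmul_linl.
move=> a; move: y; apply: linear_ext.
- by move=> c u v; rewrite gmul_linl gmul_linr.
- by move=> c u v; rewrite gmul_linr gmul_linl.
move=> b; move: z; apply: linear_ext.
- by move=> c u v; rewrite !gmul_linr.
- exact: gmul_linr.
by move=> c; rewrite !gmul_mon addrA.
Qed.

Lemma gmul1g : left_id (mon 0) gmul.
Proof.
apply: linear_ext; [exact: gmul_linr | by [] | move=> a].
by rewrite gmul_mon add0r.
Qed.

Lemma gmulDl : left_distributive gmul +%R.
Proof.
by move=> x y z; have := gmul_linl z 1 x y; rewrite !scale1r.
Qed.

Lemma gone_neq0 : mon 0 != 0.
Proof.
by apply/eqP => /(congr1 (gcoef 0))/eqP; rewrite gcoef_mon gcoef0 eqxx oner_eq0.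
Qed.

HB.instance Definition _ := GRing.Zmodule_isComNzRing.Build grpalg
  gmulA gmulC gmul1g gmulDl gone_neq0.

Lemma gscaleAl (c : F) (x y : grpalg) : c *: (x * y) = c *: x * y.
Proof.
by rewrite -[LHS]/(c *: gmul x y) -[RHS]/(gmul (c *: x) y) !gmulE linearZ_LR.
Qed.

HB.instance Definition _ := GRing.Lmodule_isLalgebra.Build F grpalg gscaleAl.

Lemma gscaleAr (c : F) (x y : grpalg) : c *: (x * y) = x * (c *: y).
Proof. by rewrite mulrC gscaleAl mulrC. Qed.

HB.instance Definition _ := GRing.Lalgebra_isAlgebra.Build F grpalg gscaleAr.

Lemma mon0 : mon 0 = 1. Proof. by []. Qed.

Lemma monD a b : mon (a + b) = mon a * mon b.
Proof. by rewrite -gmul_mon. Qed.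

Lemma monMn a k : mon (a *+ k) = mon a ^+ k.
Proof. by elim: k => [|k IH]; rewrite ?mulr0n // mulrS monD IH exprS. Qed.

Lemma linext_is_monoid_morphism (V : comAlgType F) (h : K -> V) :
  h 0 = 1 -> (forall a b, h (a + b) = h a * h b) ->
  monoid_morphism (linext h).
Proof.
move=> h0 hD; split; first by rewrite -[1]/(mon 0) linext_mon.
move=> x y; move: x; apply: linear_ext.
- by move=> c u v; rewrite mulrDl -scalerAl linearP.
- by move=> c u v; rewrite linearP mulrDl -scalerAl.
move=> a; move: y; apply: linear_ext.
- by move=> c u v; rewrite mulrDr -scalerAr linearP.
- by move=> c u v; rewrite linearP mulrDr -scalerAr.
by move=> b; rewrite -monD !linext_mon hD.
Qed.

(* The ring morphism x^a |-> 1. *)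
Definition gaug : grpalg -> F := linext (fun _ => 1 : F^o).

Lemma gaug_mon a : gaug (mon a) = 1.
Proof. by rewrite /gaug linext_mon. Qed.

Lemma gaug_is_zmod_morphism : zmod_morphism gaug.
Proof. by move=> x y; rewrite /gaug raddfB. Qed.

Lemma gaug_is_monoid_morphism : monoid_morphism gaug.
Proof.
by apply: (@linext_is_monoid_morphism F^o) => // a b; rewrite mulr1.
Qed.

HB.instance Definition _ :=
  GRing.isZmodMorphism.Build grpalg F gaug gaug_is_zmod_morphism.
HB.instance Definition _ :=
  GRing.isMonoidMorphism.Build grpalg F gaug gaug_is_monoid_morphism.

Lemma gaugZ c g : gaug (c *: g) = c * gaug g.
Proof. by rewrite /gaug linearZ_LR. Qed.

(* The ring morphism x^a |-> x^(k a). *)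
Definition gadams (k : nat) : grpalg -> grpalg :=
  linext (fun a => mon (a *+ k)).

HB.instance Definition _ k := GRing.Linear.on (gadams k).

Lemma gadams_is_monoid_morphism k : monoid_morphism (gadams k).
Proof.
apply: linext_is_monoid_morphism => [|a b]; first by rewrite mul0rn.
by rewrite mulrnDl monD.
Qed.

HB.instance Definition _ k :=
  GRing.isMonoidMorphism.Build grpalg grpalg (gadams k)
    (gadams_is_monoid_morphism k).

Lemma gadamsM k x y : gadams k (x * y) = gadams k x * gadams k y.
Proof. exact: (gadams_is_monoid_morphism k).2. Qed.

Lemma gadams_mon k a : gadams k (mon a) = mon (a *+ k).
Proof. exact: linext_mon. Qed.

Lemma gadams1 g : gadams 1 g = g.
Proof.
move: g; apply: linear_ext; [exact: linearP | by [] | move=> a].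
by rewrite gadams_mon mulr1n.
Qed.

Lemma gadams_comp k j g : gadams k (gadams j g) = gadams (k * j) g.
Proof.
move: g; apply: linear_ext; [|exact: linearP|] => [c x y|a].
  by rewrite !linearP.
by rewrite !gadams_mon -mulrnA mulnC.
Qed.

Lemma gaug_adams k g : gaug (gadams k g) = gaug g.
Proof.
have l1 : linear (fun x => gaug (gadams k x) : F^o).
  by move=> c x y; rewrite linearP /gaug linearP.
have l2 : linear (gaug : grpalg -> F^o) by move=> c x y; rewrite /gaug linearP.
by apply: (linear_ext l1 l2) => a; rewrite gadams_mon !gaug_mon.
Qed.

HB.instance Definition _ := isPsiRing.Build grpalg
  (fun k _ => @raddfB _ _ (gadams k)) (fun k _ => gadams_is_monoid_morphism k)
  gadams1 (fun k j _ _ => @gadams_comp k j).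

End GroupAlgebra.

Section Ideals.
Variable R : comNzRingType.

Definition ideal_gen (S : R -> Prop) : {pred R} := fun x =>
  `[< exists s : seq (R * R),
        (forall p, p \in s -> S p.2) /\ x = \sum_(p <- s) p.1 * p.2 >].

Lemma ideal_genP (S : R -> Prop) x :
  reflect (exists s : seq (R * R),
             (forall p, p \in s -> S p.2) /\ x = \sum_(p <- s) p.1 * p.2)
          (x \in ideal_gen S).
Proof. exact: asboolP. Qed.

Lemma ideal_gen_ind (S P : R -> Prop) :
  P 0 -> (forall x y, P x -> P y -> P (x + y)) ->
  (forall a x, S x -> P (a * x)) -> forall x, x \in ideal_gen S -> P x.
Proof.
move=> P0 PD PS x /ideal_genP[s [sS ->]].
elim: s sS => [|p s IH] sS; first by rewrite big_nil.
rewrite big_cons; apply: PD; first by apply/PS/sS/mem_head.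
by apply: IH => q qs; apply: sS; rewrite inE qs orbT.
Qed.

Lemma ideal_gen_lin (S : R -> Prop) a :
  {in ideal_gen S &, forall u v, a * u + v \in ideal_gen S}.
Proof.
move=> u v /ideal_genP[s [sS ->]] /ideal_genP[t [tS ->]]; apply/ideal_genP.
exists ([seq (a * p.1, p.2) | p <- s] ++ t); split.
  move=> p; rewrite mem_cat => /orP[/mapP[q qs ->]|]; [exact: (sS q) | exact: tS].
rewrite big_cat big_map mulr_sumr; congr (_ + _).
by apply: eq_bigr => p _; rewrite mulrA.
Qed.

Lemma ideal_gen0 (S : R -> Prop) : 0 \in ideal_gen S.
Proof. by apply/ideal_genP; exists [::]; rewrite big_nil. Qed.

Lemma ideal_genZ (S : R -> Prop) a x :
  x \in ideal_gen S -> a * x \in ideal_gen S.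
Proof. by move=> Sx; rewrite -[_ * _]addr0 ideal_gen_lin ?ideal_gen0. Qed.

Lemma ideal_genD (S : R -> Prop) x y :
  x \in ideal_gen S -> y \in ideal_gen S -> x + y \in ideal_gen S.
Proof. by move=> Sx Sy; rewrite -[x]mul1r ideal_gen_lin. Qed.

Lemma mem_ideal_gen (S : R -> Prop) x : S x -> x \in ideal_gen S.
Proof.
move=> Sx; apply/ideal_genP; exists [:: (1, x)]; rewrite big_seq1 mul1r.
by split=> // p; rewrite inE => /eqP->.
Qed.

Lemma ideal_gen_closed (S : R -> Prop) :
  1 \notin ideal_gen S -> idealr_closed (ideal_gen S).
Proof. by split; [exact: ideal_gen0 | | exact: ideal_gen_lin]. Qed.

Definition ideal_pow (I : {pred R}) (N : nat) : {pred R} :=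
  ideal_gen (fun x => exists s : seq R,
    [/\ size s = N, {subset s <= I} & x = \prod_(y <- s) y]).

End Ideals.

Section IdealPowers.
Variables (R : comNzRingType) (I : idealr R).

Lemma ideal_pow_leS N x : x \in ideal_pow I N.+1 -> x \in ideal_pow I N.
Proof.
move: x; apply: ideal_gen_ind => [|x y|a x].
- exact: ideal_gen0.
- exact: ideal_genD.
case=> -[|y s] [] //= [ss] sI ->; rewrite big_cons mulrA; apply: ideal_genZ.
apply: mem_ideal_gen; exists s; split=> // z zs.
by apply: sI; rewrite inE zs orbT.
Qed.

Lemma ideal_powS_sub N x : x \in ideal_pow I N.+1 -> x \in I.
Proof.
move: x; apply: ideal_gen_ind => [|x y|a x].
- exact: rpred0.
- exact: rpredD.
case=> -[|y s] [] //= _ sI ->; apply: idealMr; rewrite big_cons mulrC idealMr //.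
by apply: sI; exact: mem_head.
Qed.

Lemma ideal_powS_closed N : idealr_closed (ideal_pow I N.+1).
Proof.
apply: ideal_gen_closed; apply/negP => /ideal_powS_sub.
by rewrite idealr1.
Qed.

HB.instance Definition _ N := isIdealr.Build R (ideal_pow I N.+1)
  (ideal_powS_closed N).

Definition ideal_powS (N : nat) : idealr R :=
  Idealr.clone R (ideal_pow I N.+1) _.

End IdealPowers.

Section PsiQuotient.
Variables (R : psiRingType) (I : idealr R).
Hypothesis Ipsi : forall k, (0 < k)%N -> {homo psi k : x / x \in I}.
Local Notation Q := {ideal_quot I}.

Definition quot_psi (k : nat) (x : Q) : Q := \pi_Q (psi k (repr x)).

Lemma quot_psi_pi k x : (0 < k)%N -> quot_psi k (\pi_Q x) = \pi_Q (psi k x).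
Proof.
move=> k0; rewrite /quot_psi; apply/eqP; rewrite -Quotient.idealrBE.
rewrite -psi_zmod_morphism //; apply: Ipsi => //.
by rewrite Quotient.idealrBE reprK.
Qed.

Lemma quot_psi_zmod_morphism k : (0 < k)%N -> zmod_morphism (quot_psi k).
Proof.
move=> k0 x y; rewrite -[x]reprK -[y]reprK -rmorphB !quot_psi_pi //.
by rewrite psi_zmod_morphism // rmorphB.
Qed.

Lemma quot_psi_monoid_morphism k : (0 < k)%N -> monoid_morphism (quot_psi k).
Proof.
move=> k0; have [p1 pM] := psi_monoid_morphism (s := R) k k0; split.
  by rewrite -(rmorph1 \pi_Q) quot_psi_pi // p1.
move=> x y; rewrite -[x]reprK -[y]reprK -rmorphM !quot_psi_pi //.
by rewrite pM rmorphM.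
Qed.

Lemma quot_psi1 x : quot_psi 1 x = x.
Proof. by rewrite -[x]reprK quot_psi_pi // psi1. Qed.

Lemma quot_psi_comp k j : (0 < k)%N -> (0 < j)%N ->
  forall x, quot_psi k (quot_psi j x) = quot_psi (k * j) x.
Proof.
move=> k0 j0 x; have kj0 : (0 < k * j)%N by rewrite muln_gt0 k0.
rewrite -[x]reprK (quot_psi_pi _ j0) (quot_psi_pi _ k0) (quot_psi_pi _ kj0).
by rewrite psi_comp.
Qed.

End PsiQuotient.

Section Completion.
Variables (R : comNzRingType) (I : idealr R).

(* tower N is R/I^(N+1); the completion is the inverse limit of
   R/I <- R/I^2 <- R/I^3 <- ... *)
Definition tower (N : nat) : comNzRingType := {ideal_quot ideal_powS I N}.

Definition tower_map (N : nat) (x : tower N.+1) : tower N :=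
  \pi_(tower N) (repr x).

Lemma tower_map_pi N (x : R) :
  tower_map (\pi_(tower N.+1) x) = \pi_(tower N) x.
Proof.
apply/eqP; rewrite -Quotient.idealrBE; apply: ideal_pow_leS.
by rewrite (Quotient.idealrBE (ideal_powS I N.+1)) reprK.
Qed.

Lemma tower_map_is_zmod_morphism N : zmod_morphism (@tower_map N).
Proof.
move=> x y; rewrite -[x]reprK -[y]reprK.
rewrite -(rmorphB \pi_(tower N.+1)) !tower_map_pi.
exact: (rmorphB \pi_(tower N)).
Qed.

Lemma tower_map_is_monoid_morphism N : monoid_morphism (@tower_map N).
Proof.
split.
  rewrite -(rmorph1 \pi_(tower N.+1)) tower_map_pi.
  exact: (rmorph1 \pi_(tower N)).
move=> x y; rewrite -[x]reprK -[y]reprK.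
rewrite -(rmorphM \pi_(tower N.+1)) !tower_map_pi.
exact: (rmorphM \pi_(tower N)).
Qed.

HB.instance Definition _ N := GRing.isZmodMorphism.Build (tower N.+1) (tower N)
  (@tower_map N) (@tower_map_is_zmod_morphism N).
HB.instance Definition _ N := GRing.isMonoidMorphism.Build
  (tower N.+1) (tower N) (@tower_map N) (@tower_map_is_monoid_morphism N).

Record completion : Type := Completion {
  coord : forall N, tower N;
  coordP : forall N, tower_map (coord N.+1) = coord N
}.

HB.instance Definition _ := gen_eqMixin completion.
HB.instance Definition _ := gen_choiceMixin completion.

Lemma completionP u v : (forall N, coord u N = coord v N) -> u = v.
Proof.
case: u v => [u uP] [v vP] /= eq_uv.
have eq_uv' : u = v by apply: functional_extensionality_dep.
by subst v; congr Completion; exact: Prop_irrelevance.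
Qed.

Program Definition czero := @Completion (fun N => 0) _.
Next Obligation. by rewrite rmorph0. Qed.
Program Definition copp u := @Completion (fun N => - coord u N) _.
Next Obligation. by rewrite rmorphN /= coordP. Qed.
Program Definition cadd u v := @Completion (fun N => coord u N + coord v N) _.
Next Obligation. by rewrite rmorphD /= !coordP. Qed.
Program Definition cone := @Completion (fun N => 1) _.
Next Obligation. by rewrite rmorph1. Qed.
Program Definition cmul u v := @Completion (fun N => coord u N * coord v N) _.
Next Obligation. by rewrite rmorphM /= !coordP. Qed.

Lemma caddA : associative cadd.
Proof. by move=> u v w; apply: completionP => N /=; rewrite addrA. Qed.
Lemma caddC : commutative cadd.
Proof. by move=> u v; apply: completionP => N /=; rewrite addrC. Qed.
Lemma cadd0 : left_id czero cadd.
Proof. by move=> u; apply: completionP => N /=; rewrite add0r. Qed.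
Lemma caddN : left_inverse czero copp cadd.
Proof. by move=> u; apply: completionP => N /=; rewrite addNr. Qed.

HB.instance Definition _ :=
  GRing.isZmodule.Build completion caddA caddC cadd0 caddN.

Lemma cmulA : associative cmul.
Proof. by move=> u v w; apply: completionP => N /=; rewrite mulrA. Qed.
Lemma cmulC : commutative cmul.
Proof. by move=> u v; apply: completionP => N /=; rewrite mulrC. Qed.
Lemma cmul1 : left_id cone cmul.
Proof. by move=> u; apply: completionP => N /=; rewrite mul1r. Qed.
Lemma cmulDl : left_distributive cmul cadd.
Proof. by move=> u v w; apply: completionP => N /=; rewrite mulrDl. Qed.
Lemma cone_neq0 : cone != 0.
Proof. by apply/eqP => /(congr1 (coord^~ 0)) /eqP; rewrite /= oner_eq0. Qed.

HB.instance Definition _ := GRing.Zmodule_isComNzRing.Build completion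
  cmulA cmulC cmul1 cmulDl cone_neq0.

End Completion.

Section PsiCompletion.
Variables (R : psiRingType) (I : idealr R).
Hypothesis Ipsi : forall k, (0 < k)%N -> {homo psi k : x / x \in I}.

Lemma ideal_pow_psi k N x : (0 < k)%N ->
  x \in ideal_pow I N -> psi k x \in ideal_pow I N.
Proof.
move=> k0; have pB := psi_zmod_morphism (s := R) k k0.
have [p1 pM] := psi_monoid_morphism (s := R) k k0.
have p0 : psi k 0 = 0 :> R by have := pB 0 0; rewrite !subr0 subrr.
have pN : {morph psi k : u / - u : R} by move=> u; rewrite -sub0r pB p0 sub0r.
have pD : {morph psi k : u v / u + v : R}.
  by move=> u v; rewrite -[v]opprK pB pN !opprK.
move: x; apply: ideal_gen_ind => [|x y|a x].
- by rewrite p0; exact: ideal_gen0.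
- by rewrite pD; exact: ideal_genD.
case=> s [ss sI ->]; rewrite pM; apply/ideal_genZ/mem_ideal_gen.
exists (map (psi k) s); split; first by rewrite size_map.
  by move=> z /mapP[y ys ->]; apply: Ipsi => //; apply: sI.
by rewrite big_map (big_morph _ pM p1).
Qed.

Lemma ideal_powS_psi N k : (0 < k)%N ->
  {homo psi k : x / x \in ideal_powS I N}.
Proof. by move=> k0 x; apply: ideal_pow_psi. Qed.

(* Coordinatewise [quot_psi] for k > 0; the identity for k = 0, where [psi]
   need not respect the tower. *)
Lemma completion_psi_subproof (k : nat) (u : completion I) N :
  tower_map (if (0 < k)%N then @quot_psi R (ideal_powS I N.+1) k (coord u N.+1)
             else coord u N.+1) =
  (if (0 < k)%N then @quot_psi R (ideal_powS I N) k (coord u N) else coord u N).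
Proof.
have [_|k0] := posnP k; first exact: coordP.
rewrite -(coordP u N) [X in tower_map X]/quot_psi tower_map_pi.
exact/esym/(quot_psi_pi (@ideal_powS_psi N) (repr (coord u N.+1)) k0).
Qed.

Definition completion_psi (k : nat) (u : completion I) : completion I :=
  Completion (completion_psi_subproof k u).

Lemma coord_psi k u N : (0 < k)%N ->
  coord (completion_psi k u) N = @quot_psi R (ideal_powS I N) k (coord u N).
Proof. by move=> k0 /=; rewrite k0. Qed.

Lemma completion_psi_zmod_morphism k :
  (0 < k)%N -> zmod_morphism (completion_psi k).
Proof.
move=> k0 u v; apply: completionP => N; rewrite coord_psi //=.
rewrite !k0; exact: (quot_psi_zmod_morphism (@ideal_powS_psi N)).
Qed.

Lemma completion_psi_monoid_morphism k :
  (0 < k)%N -> monoid_morphism (completion_psi k).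
Proof.
move=> k0; split=> [|u v]; apply: completionP => N; rewrite /= !k0.
  exact: (quot_psi_monoid_morphism (@ideal_powS_psi N) k0).1.
exact: (quot_psi_monoid_morphism (@ideal_powS_psi N) k0).2.
Qed.

Lemma completion_psi1 u : completion_psi 1 u = u.
Proof.
apply: completionP => N; rewrite coord_psi //.
exact: (quot_psi1 (@ideal_powS_psi N)).
Qed.

Lemma completion_psi_comp k j : (0 < k)%N -> (0 < j)%N ->
  forall u, completion_psi k (completion_psi j u) = completion_psi (k * j) u.
Proof.
move=> k0 j0 u; apply: completionP => N.
rewrite !coord_psi ?muln_gt0 ?k0 //.
exact: (quot_psi_comp (@ideal_powS_psi N)).
Qed.

End PsiCompletion.

Section VirtualKTheory.
Variables (F : fieldType) (n : nat).

(* F[x^{+-1}] *)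
Local Notation L := (grpalg F int).
Local Notation X := (@mon F int).

(* The index set is 'Z_n, which is Z/nZ for n > 1 (and Z/2Z otherwise). *)
Definition sector_rel (m : 'Z_n) : L :=
  if m == 0 then (X 1 - 1) * (X n%:Z - 1) else X n%:Z - 1.

Definition sector_ideal (m : 'Z_n) : {pred L} :=
  ideal_gen (fun f => f = sector_rel m).

Lemma sector_idealP m f :
  reflect (exists a, f = a * sector_rel m) (f \in sector_ideal m).
Proof.
apply: (iffP idP) => [|[a ->]]; last by apply/ideal_genZ/mem_ideal_gen.
move: f; apply: ideal_gen_ind => [|x y [a ->] [b ->]|a x ->].
- by exists 0; rewrite mul0r.
- by exists (a + b); rewrite mulrDl.
- by exists a.
Qed.

Lemma gaug_sector_rel m : gaug (sector_rel m) = 0.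
Proof.
by rewrite /sector_rel; case: ifP; rewrite ?rmorphM ?rmorphB ?rmorph1 /=
  ?gaug_mon ?subrr ?mulr0.
Qed.

Lemma sector_ideal_closed m : idealr_closed (sector_ideal m).
Proof.
apply: ideal_gen_closed; apply/negP => /sector_idealP[a].
move/(congr1 (@gaug F int)); rewrite rmorphM rmorph1 /= gaug_sector_rel mulr0.
by move/eqP; rewrite oner_eq0.
Qed.

HB.instance Definition _ m := isIdealr.Build L (sector_ideal m)
  (sector_ideal_closed m).

Definition sector (m : 'Z_n) : comNzRingType :=
  {ideal_quot (Idealr.clone L (sector_ideal m) _ : idealr L)}.

(* K(IP(1,n)) with coefficients in F, through its presentation as the direct
   sum of the rings F[x_0^{+-1}]/((x_0 - 1)(x_0^n - 1)) and, for m != 0,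
   F[x_m^{+-1}]/(x_m^n - 1).  The ring structure put on it below is the virtual
   product, not the componentwise one. *)
Definition virtualK : Type := {dffun forall m : 'Z_n, sector m}.

HB.instance Definition _ := Choice.on virtualK.

(* Class of a family of Laurent polynomials, and a choice of representatives. *)
Definition vclass (f : 'Z_n -> L) : virtualK :=
  [ffun m : 'Z_n => \pi_(sector m) (f m)].
Definition vrep (u : virtualK) (m : 'Z_n) : L := repr (u m).

(* The class e(m1, m2) in the summand of index m1 + m2. *)
Definition euler (m1 m2 : 'Z_n) : L :=
  if (m1 == 0) || (m2 == 0) then 1
  else if m1 + m2 == 0 then (1 - X (-1)) ^+ 2
  else 1 - X (-1).

Definition theta (k : nat) : L := \sum_(i < k) X (- i%:Z).

(* The operations are defined on families of Laurent polynomials; that they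
   descend to virtualK is vmulE, vpsi_class and vaug_class, and their values on
   the monomials x_m^a are given by vmul_mon, vpsi_mon0, vpsi_mon, vaug_mon0 and
   vaug_mon. *)
Definition lift_mul (f g : 'Z_n -> L) (m : 'Z_n) : L :=
  \sum_(m1 : 'Z_n) f m1 * g (m - m1) * euler m1 (m - m1).
Definition lift_psi (k : nat) (f : 'Z_n -> L) (m : 'Z_n) : L :=
  if m == 0 then gadams k (f m) else gadams k (f m) * theta k.
Definition lift_one (m : 'Z_n) : L := (m == 0)%:R.
Definition lift_aug (f : 'Z_n -> L) (m : 'Z_n) : L :=
  if m == 0 then (gaug (f 0))%:A else 0.

Definition vadd (u v : virtualK) := vclass (fun m => vrep u m + vrep v m).
Definition vopp (u : virtualK) := vclass (fun m => - vrep u m).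
Definition vzero := vclass (fun => 0).
Definition vone := vclass lift_one.
Definition vmul (u v : virtualK) := vclass (lift_mul (vrep u) (vrep v)).
Definition vpsi (k : nat) (u : virtualK) := vclass (lift_psi k (vrep u)).
Definition vaug (u : virtualK) := vclass (lift_aug (vrep u)).

Definition veq (f g : 'Z_n -> L) : Prop :=
  forall m, f m - g m \in sector_ideal m.

Lemma vclass_eq f g : vclass f = vclass g <-> veq f g.
Proof.
split=> [E m|E].
  have /(congr1 (fun h : virtualK => h m)) := E; rewrite !ffunE => /eqP.
  by rewrite -Quotient.idealrBE.
apply/ffunP => m; rewrite !ffunE; apply/eqP; rewrite -Quotient.idealrBE.
exact: E.
Qed.

Lemma vrepK u : vclass (vrep u) = u.
Proof. by apply/ffunP => m; rewrite ffunE reprK. Qed.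

Lemma vrep_class f : veq (vrep (vclass f)) f.
Proof. by apply/vclass_eq; rewrite vrepK. Qed.

Lemma virtualK_ind (P : virtualK -> Prop) :
  (forall f, P (vclass f)) -> forall u, P u.
Proof. by move=> Pc u; rewrite -[u]vrepK. Qed.

Lemma vaddE f g : vadd (vclass f) (vclass g) = vclass (fun m => f m + g m).
Proof.
apply/vclass_eq => m; rewrite opprD addrACA.
by apply: ideal_genD; apply: vrep_class.
Qed.

Lemma voppE f : vopp (vclass f) = vclass (fun m => - f m).
Proof.
apply/vclass_eq => m; rewrite -opprD -mulN1r; apply: ideal_genZ.
exact: vrep_class.
Qed.

Lemma vaddA : associative vadd.
Proof.
elim/virtualK_ind=> f; elim/virtualK_ind=> g; elim/virtualK_ind=> h.
by rewrite !vaddE; congr vclass; apply: funext => m; rewrite addrA.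
Qed.

Lemma vaddC : commutative vadd.
Proof.
elim/virtualK_ind=> f; elim/virtualK_ind=> g.
by rewrite !vaddE; congr vclass; apply: funext => m; rewrite addrC.
Qed.

Lemma vadd0 : left_id vzero vadd.
Proof.
elim/virtualK_ind=> f.
by rewrite !vaddE; congr vclass; apply: funext => m; rewrite add0r.
Qed.

Lemma vaddN : left_inverse vzero vopp vadd.
Proof.
elim/virtualK_ind=> f.
by rewrite voppE vaddE; congr vclass; apply: funext => m; rewrite addNr.
Qed.

HB.instance Definition _ := GRing.isZmodule.Build virtualK
  vaddA vaddC vadd0 vaddN.

Let d (m : 'Z_n) : nat := (m != 0).

Lemma d_subadd (m1 m2 : 'Z_n) : (d (m1 + m2)%R <= d m1 + d m2)%N.
Proof.
rewrite /d; have [->|] := eqVneq m1 0; first by rewrite add0r.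
by move=> _; exact: leq_trans (leq_b1 _) (leq_addr _ _).
Qed.

Lemma eulerE m1 m2 :
  euler m1 m2 = (1 - X (-1)) ^+ (d m1 + d m2 - d (m1 + m2)%R).
Proof.
rewrite /euler /d; have [->|m10] /= := eqVneq m1 0.
  by rewrite add0r add0n subnn.
have [->|m20] /= := eqVneq m2 0; first by rewrite addr0 m10.
by case: eqVneq.
Qed.

Lemma eulerC m1 m2 : euler m1 m2 = euler m2 m1.
Proof. by rewrite !eulerE (addnC (d m1)) (addrC m1). Qed.

Lemma eulerA m1 m2 m3 : euler m1 m2 * euler (m1 + m2) m3 =
  euler m2 m3 * euler m1 (m2 + m3).
Proof.
rewrite !eulerE -!exprD; congr (_ ^+ _); rewrite addrA.
have := d_subadd m1 m2; have := d_subadd m2 m3.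
have := d_subadd (m1 + m2)%R m3; have := d_subadd m1 (m2 + m3).
rewrite addrA.
move: (d _) (d (m1 + m2)%R) (d m1) (d m2) (d m3) (d (m2 + m3)%R) => *; lia.
Qed.

Lemma euler_sector m1 m2 x : x \in sector_ideal m2 ->
  x * euler m1 m2 \in sector_ideal (m1 + m2).
Proof.
move=> /sector_idealP[a ->]; rewrite -mulrA; apply: ideal_genZ.
apply/sector_idealP; rewrite /sector_rel /euler.
have [->|m10] /= := eqVneq m1 0; first by rewrite add0r; exists 1; rewrite mul1r mulr1.
have [->|m20] /= := eqVneq m2 0.
  by rewrite addr0 (negbTE m10) mulr1; exists (X 1 - 1).
case: eqVneq => _; last first.
  by exists (1 - X (-1)); rewrite [RHS]mulrC.
exists ((1 - X (-1)) * X (-1)).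
have -> : 1 - X (-1) = X (-1) * (X 1 - 1).
  by rewrite mulrBr mulr1 -monD addNr.
by ring.
Qed.

Lemma lift_mulC f g m : lift_mul f g m = lift_mul g f m.
Proof.
have h : @injective 'Z_n 'Z_n (fun a => m - a) by exact: subrI.
rewrite /lift_mul (reindex_inj h) /=; apply: eq_bigr => a _.
by rewrite subKr (eulerC a) [g _ * _]mulrC.
Qed.

Lemma lift_mulA f g h m :
  lift_mul f (lift_mul g h) m = lift_mul (lift_mul f g) h m.
Proof.
rewrite /lift_mul.
under eq_bigr => a _ do rewrite mulr_sumr mulr_suml.
under [RHS]eq_bigr => a _ do rewrite mulr_suml mulr_suml.
rewrite [RHS]exchange_big /=; apply: eq_bigr => a _.
have inj_a : @injective 'Z_n 'Z_n (fun b => a + b) by exact: addrI.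
rewrite [RHS](reindex_inj inj_a) /=; apply: eq_bigr => b _.
have -> : a + b - a = b by rewrite addrAC subrr add0r.
rewrite opprD !addrA; set c := m - a - b.
have -> : m - a = b + c by rewrite /c [_ - b]addrC addrA subrr add0r.
have := eulerA a b c; set e1 := euler a b; set e2 := euler _ c.
set e3 := euler b c; set e4 := euler a _ => E.
rewrite (_ : f a * _ * _ = f a * g b * h c * (e3 * e4)); last by ring.
by rewrite -E; ring.
Qed.

Lemma lift_mulDl f1 f2 g m :
  lift_mul (fun m => f1 m + f2 m) g m = lift_mul f1 g m + lift_mul f2 g m.
Proof.
by rewrite /lift_mul -big_split; apply: eq_bigr => a _; rewrite !mulrDl.
Qed.

Lemma lift_mul_veq f g1 g2 : veq g1 g2 -> veq (lift_mul f g1) (lift_mul f g2).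
Proof.
move=> E m; rewrite /lift_mul -sumrB.
apply: (big_ind (fun x => x \in sector_ideal m)).
- exact: ideal_gen0.
- by move=> x y; exact: ideal_genD.
move=> a _; rewrite -mulrBl -mulrBr -mulrA; apply: ideal_genZ.
have := @euler_sector a (m - a) _ (E (m - a)).
by rewrite [a + _]addrC subrK.
Qed.

Lemma vmulE f g : vmul (vclass f) (vclass g) = vclass (lift_mul f g).
Proof.
rewrite /vmul; transitivity (vclass (lift_mul (vrep (vclass f)) g)).
  by apply/vclass_eq/lift_mul_veq/vrep_class.
have sym h1 h2 : lift_mul h1 h2 = lift_mul h2 h1.
  by apply: funext => m; exact: lift_mulC.
by rewrite !(sym _ g); apply/vclass_eq/lift_mul_veq/vrep_class.
Qed.

Lemma vmulA : associative vmul.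
Proof.
elim/virtualK_ind=> f; elim/virtualK_ind=> g; elim/virtualK_ind=> h.
by rewrite !vmulE; congr vclass; apply: funext => m; rewrite lift_mulA.
Qed.

Lemma vmulC : commutative vmul.
Proof.
elim/virtualK_ind=> f; elim/virtualK_ind=> g.
by rewrite !vmulE; congr vclass; apply: funext => m; rewrite lift_mulC.
Qed.

Lemma vmul1 : left_id vone vmul.
Proof.
elim/virtualK_ind=> f; rewrite vmulE; congr vclass; apply: funext => m.
rewrite /lift_mul (bigD1 0) //= big1 => [|a a0].
  by rewrite /lift_one eqxx /euler eqxx subr0 /= mul1r mulr1 addr0.
by rewrite /lift_one (negbTE a0) !mul0r.
Qed.

Lemma vmulDl : left_distributive vmul vadd.
Proof.
elim/virtualK_ind=> f; elim/virtualK_ind=> g; elim/virtualK_ind=> h.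
rewrite (vaddE f g) !vmulE vaddE; congr vclass; apply: funext => m.
exact: lift_mulDl.
Qed.

Lemma vone_neq0 : vone != 0.
Proof.
apply/eqP => /vclass_eq/(_ 0) /=; rewrite /lift_one eqxx subr0.
by apply/negP; case: (sector_ideal_closed 0).
Qed.

HB.instance Definition _ := GRing.Zmodule_isComNzRing.Build virtualK
  vmulA vmulC vmul1 vmulDl vone_neq0.

Lemma vclassB f g : vclass f - vclass g = vclass (fun m => f m - g m).
Proof.
by rewrite -[LHS]/(vadd (vclass f) (vopp (vclass g))) voppE vaddE.
Qed.

Lemma vclassM f g : vclass f * vclass g = vclass (lift_mul f g).
Proof. exact: vmulE. Qed.

(* f(x_m), in the summand of index m; in particular vsec m (X a) is x_m^a. *)
Definition vsec (m : 'Z_n) (f : L) : virtualK :=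
  vclass (fun m' => if m' == m then f else 0).

Lemma vsecM m1 m2 f1 f2 :
  vsec m1 f1 * vsec m2 f2 = vsec (m1 + m2) (f1 * f2 * euler m1 m2).
Proof.
rewrite vclassM; congr vclass; apply: funext => m; rewrite /lift_mul.
rewrite (bigD1 m1) //= big1 => [|a /negbTE ->]; last by rewrite !mul0r.
rewrite eqxx addr0 subr_eq [m2 + m1]addrC; case: eqVneq => [->|_].
  by rewrite addrAC subrr add0r.
by rewrite mulr0 mul0r.
Qed.

Lemma vclass_sum f : vclass f = \sum_m vsec m (f m).
Proof.
have cD : {morph vclass : g h / (fun m => g m + h m) >-> g + h}.
  by move=> g h; exact/esym/vaddE.
have E (r : seq 'Z_n) : \sum_(m <- r) vsec m (f m) =
    vclass (fun m' => \sum_(m <- r) (if m' == m then f m else 0)).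
  elim: r => [|m r IH].
    by rewrite big_nil; congr vclass; apply: funext => m'; rewrite big_nil.
  rewrite big_cons IH -cD; congr vclass; apply: funext => m'.
  by rewrite big_cons.
rewrite E; congr vclass; apply: funext => m.
by rewrite -big_mkcond /= (big_pred1 m) // => a; rewrite eq_sym.
Qed.

Lemma vmul_mon m1 m2 a1 a2 :
  vsec m1 (X a1) * vsec m2 (X a2) =
  vsec (m1 + m2) (X (a1 + a2) * euler m1 m2).
Proof. by rewrite vsecM monD. Qed.

Lemma vsec_one : vsec 0 1 = 1.
Proof. by congr vclass; apply: funext => m; rewrite /lift_one; case: eqP. Qed.

Lemma lift_psiB k f g m :
  lift_psi k (fun m => f m - g m) m = lift_psi k f m - lift_psi k g m.
Proof. by rewrite /lift_psi; case: ifP; rewrite raddfB ?mulrBl. Qed.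

Lemma dvdX1 (k : nat) (a : int) : exists b, X (a *+ k) - 1 = b * (X a - 1).
Proof.
by rewrite monMn subrX1 mulrC; eexists.
Qed.

Lemma psi_sector (k : nat) m x :
  x \in sector_ideal m -> gadams k x \in sector_ideal m.
Proof.
move=> /sector_idealP[a ->]; rewrite rmorphM; apply: ideal_genZ.
apply/sector_idealP; rewrite /sector_rel; case: ifP => _.
  rewrite rmorphM !rmorphB !rmorph1 /= !gadams_mon.
  have [b ->] := dvdX1 k 1; have [c ->] := dvdX1 k n%:Z.
  by exists (b * c); rewrite mulrACA.
rewrite rmorphB rmorph1 /= gadams_mon; exact: dvdX1.
Qed.

Lemma vpsi_class k f : vpsi k (vclass f) = vclass (lift_psi k f).
Proof.
apply/vclass_eq => m; rewrite -lift_psiB /lift_psi.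
have := psi_sector k (vrep_class f m).
by case: ifP => // _ H; rewrite mulrC; apply: ideal_genZ.
Qed.

Lemma vpsi_sec k m f : vpsi k (vsec m f) =
  vsec m (if m == 0 then gadams k f else gadams k f * theta k).
Proof.
rewrite vpsi_class; congr vclass; apply: funext => m'; rewrite /lift_psi.
by have [->|_] := eqVneq m' m; rewrite // raddf0 mul0r if_same.
Qed.

Lemma vpsi_mon0 k a : vpsi k (vsec 0 (X a)) = vsec 0 (X (a *+ k)).
Proof. by rewrite vpsi_sec eqxx gadams_mon. Qed.

Lemma vpsi_mon k m a : m != 0 ->
  vpsi k (vsec m (X a)) = vsec m (X (a *+ k) * \sum_(i < k) X (- i%:Z)).
Proof. by move=> /negbTE m0; rewrite vpsi_sec m0 gadams_mon. Qed.

Lemma lift_psiE k f m : lift_psi k f m = gadams k (f m) * theta k ^+ d m.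
Proof. by rewrite /lift_psi /d; case: eqP; rewrite ?mulr1. Qed.

Lemma gadams_theta k : gadams k (1 - X (-1)) = (1 - X (-1)) * theta k.
Proof.
rewrite rmorphB rmorph1 /= gadams_mon monMn /theta.
under [X in _ * X]eq_bigr => i _.
  rewrite (_ : - i%:Z = -1 *+ i) ?monMn; last by rewrite mulNrn -natz.
  over.
by rewrite -opprB subrX1 -mulNr opprB.
Qed.

Lemma gadams_euler k m1 m2 :
  gadams k (euler m1 m2) * theta k ^+ d (m1 + m2)%R =
  euler m1 m2 * (theta k ^+ d m1 * theta k ^+ d m2).
Proof.
rewrite eulerE rmorphXn /= gadams_theta exprMn -mulrA -!exprD.
by rewrite subnK // d_subadd.
Qed.

Lemma lift_psi_mul k f g m :
  lift_psi k (lift_mul f g) m = lift_mul (lift_psi k f) (lift_psi k g) m.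
Proof.
rewrite lift_psiE /lift_mul raddf_sum mulr_suml; apply: eq_bigr => a _.
have am : a + (m - a) = m by rewrite addrC subrK.
have E := gadams_euler k a (m - a); rewrite am in E.
rewrite /= !gadamsM -mulrA E !lift_psiE; ring.
Qed.

Lemma vpsi_zmod_morphism k : zmod_morphism (vpsi k).
Proof.
elim/virtualK_ind=> f; elim/virtualK_ind=> g.
rewrite vclassB !vpsi_class vclassB; congr vclass; apply: funext => m.
exact: lift_psiB.
Qed.

Lemma vpsi_monoid_morphism k : monoid_morphism (vpsi k).
Proof.
split.
  by rewrite -vsec_one -mon0 vpsi_mon0 mul0rn.
elim/virtualK_ind=> f; elim/virtualK_ind=> g.
rewrite vclassM !vpsi_class vclassM; congr vclass; apply: funext => m.
exact: lift_psi_mul.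
Qed.

Lemma vpsi1 u : vpsi 1 u = u.
Proof.
elim/virtualK_ind: u => f; rewrite vpsi_class; congr vclass; apply: funext => m.
by rewrite lift_psiE gadams1 /theta big_ord1 oppr0 mon0 expr1n mulr1.
Qed.

Lemma theta_comp k j : gadams k (theta j) * theta k = theta (k * j).
Proof.
have E : theta (k * j) =
    \sum_(0 <= q < j) \sum_(q * k <= i < q.+1 * k) X (- i%:Z).
  by rewrite /theta mulnC -(big_mkord xpredT (fun i => X (- i%:Z))) big_nat_mul.
rewrite E big_mkord [X in gadams k X]/theta raddf_sum mulr_suml.
apply: eq_bigr => q _; rewrite /= gadams_mon /theta mulr_sumr.
rewrite -{1}[(q * k)%N]add0n big_addn mulSn addnK big_mkord.
by apply: eq_bigr => i _; rewrite -monD; congr mon; lia.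
Qed.

Lemma vpsi_comp k j u : vpsi k (vpsi j u) = vpsi (k * j) u.
Proof.
elim/virtualK_ind: u => f; rewrite !vpsi_class; congr vclass.
apply: funext => m; rewrite !lift_psiE gadamsM gadams_comp -mulrA.
by rewrite -(theta_comp k j) exprMn rmorphXn.
Qed.

HB.instance Definition _ := isPsiRing.Build virtualK
  (fun k _ => @vpsi_zmod_morphism k) (fun k _ => @vpsi_monoid_morphism k)
  vpsi1 (fun k j _ _ => @vpsi_comp k j).

Lemma lift_augB f g m :
  lift_aug (fun m => f m - g m) m = lift_aug f m - lift_aug g m.
Proof.
rewrite /lift_aug; case: ifP => _; last by rewrite subrr.
by rewrite rmorphB scalerBl.
Qed.

Lemma gaug_sector m x : x \in sector_ideal m -> gaug x = 0.
Proof.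
by case/sector_idealP=> a ->; rewrite rmorphM /= gaug_sector_rel mulr0.
Qed.

Lemma vaug_class f : vaug (vclass f) = vclass (lift_aug f).
Proof.
apply/vclass_eq => m; rewrite -lift_augB /lift_aug; case: ifP => _.
  by rewrite (gaug_sector (vrep_class f 0)) scale0r ideal_gen0.
exact: ideal_gen0.
Qed.

Lemma vaug_mon0 a : vaug (vsec 0 (X a)) = 1.
Proof.
rewrite vaug_class; congr vclass; apply: funext => m.
by rewrite /lift_aug /lift_one; case: eqP => //; rewrite eqxx gaug_mon scale1r.
Qed.

Lemma vaug_mon m a : m != 0 -> vaug (vsec m (X a)) = 0.
Proof.
move=> m0; rewrite vaug_class; congr vclass; apply: funext => m'.
by rewrite /lift_aug [0 == m]eq_sym (negbTE m0) rmorph0 scale0r if_same.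
Qed.

Lemma gaug_euler m1 m2 : gaug (euler m1 m2) = ((m1 == 0) || (m2 == 0))%:R.
Proof.
rewrite /euler; do ![case: ifP => _]; rewrite ?rmorph1 ?rmorphXn //=.
all: by rewrite rmorphB rmorph1 /= gaug_mon subrr ?expr0n.
Qed.

Lemma vaug_zmod_morphism : zmod_morphism vaug.
Proof.
elim/virtualK_ind=> f; elim/virtualK_ind=> g.
rewrite vclassB !vaug_class vclassB; congr vclass; apply: funext => m.
exact: lift_augB.
Qed.

Lemma vaug_monoid_morphism : monoid_morphism vaug.
Proof.
split; first by rewrite -{1}vsec_one -mon0 vaug_mon0.
elim/virtualK_ind=> f; elim/virtualK_ind=> g.
rewrite vclassM !vaug_class vclassM; congr vclass; apply: funext => m.
have E : gaug (lift_mul f g 0) = gaug (f 0) * gaug (g 0).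
  rewrite /lift_mul raddf_sum (bigD1 0) //= big1 => [|a a0].
    by rewrite subr0 !rmorphM /= gaug_euler eqxx mulr1 addr0.
  by rewrite !rmorphM /= gaug_euler sub0r oppr_eq0 (negbTE a0) mulr0.
rewrite {2}/lift_mul (bigD1 0) //= big1 => [|a a0]; last first.
  by rewrite /lift_aug (negbTE a0) !mul0r.
rewrite /lift_aug eqxx subr0 E addr0; case: eqVneq => [->|_].
  by rewrite /euler eqxx mulr1 -scalerAl mul1r scalerA.
by rewrite mulr0 mul0r.
Qed.

HB.instance Definition _ :=
  GRing.isZmodMorphism.Build virtualK virtualK vaug vaug_zmod_morphism.
HB.instance Definition _ :=
  GRing.isMonoidMorphism.Build virtualK virtualK vaug vaug_monoid_morphism.

Lemma vaug_psi k u : vaug (psi k u) = vaug u.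
Proof.
elim/virtualK_ind: u => f; rewrite [psi _ _]vpsi_class !vaug_class.
congr vclass; apply: funext => m; rewrite /lift_aug; case: ifP => // _.
by rewrite /lift_psi eqxx gaug_adams.
Qed.

Lemma psi_vaug k u : psi k (vaug u) = vaug u.
Proof.
elim/virtualK_ind: u => f; rewrite vaug_class [psi _ _]vpsi_class.
congr vclass; apply: funext => m; rewrite /lift_psi /lift_aug.
have [m0|m0] := eqVneq m 0; last by rewrite raddf0 mul0r.
by rewrite linearZ_LR /= -mon0 gadams_mon mul0rn.
Qed.

Definition vaug_ker : {pred virtualK} := fun u => vaug u == 0.

Lemma vaug_ker_closed : idealr_closed vaug_ker.
Proof.
split; rewrite -?topredE /= /vaug_ker ?rmorph0 ?rmorph1 ?oner_eq0 // => a u v.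
rewrite -!topredE /= => /eqP u0 /eqP v0.
by rewrite rmorphD rmorphM /= u0 v0 mulr0 addr0.
Qed.

HB.instance Definition _ := isIdealr.Build virtualK vaug_ker vaug_ker_closed.

Definition virtualK_hat : Type :=
  completion (Idealr.clone virtualK vaug_ker _ : idealr virtualK).

HB.instance Definition _ := GRing.ComNzRing.on virtualK_hat.

Lemma vaug_ker_psi k : (0 < k)%N ->
  {homo psi k : u / u \in Idealr.clone virtualK vaug_ker _}.
Proof. by move=> _ u; rewrite -!topredE /= /vaug_ker vaug_psi. Qed.

HB.instance Definition _ := isPsiRing.Build virtualK_hat
  (completion_psi_zmod_morphism vaug_ker_psi)
  (completion_psi_monoid_morphism vaug_ker_psi)
  (completion_psi1 vaug_ker_psi) (completion_psi_comp vaug_ker_psi).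

End VirtualKTheory.

Section ResolutionKTheory.
Variables (F : fieldType) (n : nat).

(* F[chi_0^{+-1}, ..., chi_{n-1}^{+-1}] *)
Local Notation L := (grpalg F {ffun 'I_n -> int}).

Definition chi (i : 'I_n) : L := mon F [ffun j => (j == i)%:Z].

Definition resolution_ideal : {pred L} :=
  ideal_gen (fun f => exists i j, f = (chi i - 1) * (chi j - 1)).

Lemma resolution_gaug f : f \in resolution_ideal -> gaug f = 0.
Proof.
move: f; apply: ideal_gen_ind => [|x y|a _ [i [j ->]]].
- by rewrite rmorph0.
- by rewrite rmorphD /= => -> ->; rewrite addr0.
by rewrite !rmorphM !rmorphB rmorph1 /= !gaug_mon subrr !mulr0.
Qed.

Lemma resolution_ideal_closed : idealr_closed resolution_ideal.
Proof.
apply: ideal_gen_closed; apply/negP => /resolution_gaug.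
by move/eqP; rewrite rmorph1 oner_eq0.
Qed.

HB.instance Definition _ := isIdealr.Build L resolution_ideal
  resolution_ideal_closed.

(* K(Z_n) with coefficients in F, through its presentation.  The Adams
   operations are induced by the F-linear ring endomorphisms sending a Laurent
   monomial to its k-th power; see psi_chi. *)
Definition resolutionK : Type :=
  {ideal_quot (Idealr.clone L resolution_ideal _ : idealr L)}.

HB.instance Definition _ := GRing.ComNzRing.on resolutionK.

Lemma psi_chi k i : psi k (chi i) = chi i ^+ k.
Proof. by rewrite [LHS]gadams_mon monMn. Qed.

Lemma psi_resolution_ideal k f :
  f \in resolution_ideal -> psi k f \in resolution_ideal.
Proof.
move: f; apply: ideal_gen_ind => [|x y|a _ [i [j ->]]].
- by rewrite [psi _ _]raddf0; exact: ideal_gen0.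
- by rewrite [psi _ (_ + _)]raddfD; exact: ideal_genD.
have E l : gadams k (chi l - 1) = (\sum_(s < k) chi l ^+ s) * (chi l - 1).
  by rewrite rmorphB rmorph1 /= [gadams k _]psi_chi subrX1 mulrC.
rewrite [psi _ _]gadamsM gadamsM !E mulrACA; do 2!apply: ideal_genZ.
by apply: mem_ideal_gen; exists i, j.
Qed.

Lemma resolution_ideal_psi k : (0 < k)%N ->
  {homo psi k : f / f \in Idealr.clone L resolution_ideal _}.
Proof. by move=> _ f; exact: psi_resolution_ideal. Qed.

HB.instance Definition _ := isPsiRing.Build resolutionK
  (quot_psi_zmod_morphism resolution_ideal_psi)
  (quot_psi_monoid_morphism resolution_ideal_psi)
  (quot_psi1 resolution_ideal_psi) (quot_psi_comp resolution_ideal_psi).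

End ResolutionKTheory.

(* Main.v *)
From HB Require Import structures.
Require Import Defs.
From mathcomp Require Import all_boot all_order all_algebra.
From mathcomp Require Import generic_quotient ring_quotient.
From mathcomp Require Import boolp reals complex ring.

Set Implicit Arguments.
Unset Strict Implicit.
Unset Printing Implicit Defensive.

Import GRing.Theory Num.Theory.
Local Open Scope ring_scope.
Local Open Scope quotient_scope.

(* Both sides are C + V with V^2 = 0, dim V = n, and psi^k = k on V.  For
   K(Z_n) this is the first-order Taylor expansion at
   chi_0 = ... = chi_{n-1} = 1.
   For the virtual side, let I be the augmentation ideal and y = x_0 - 1.  As
   1 + x + ... + x^(n-1) is n modulo x - 1, the class of y^2 in A_0 is divisible
   by y^3, and in A_m (m <> 0) the class of x_m - 1 by (x_m - 1)^2.  Hence the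
   powers I^N are all equal for N >= 2, the completion is K/I^2, and sending f
   to the tuple (f_0(1), f_0'(1), f_1(1), ..., f_{n-1}(1)), read as Taylor
   coefficients, identifies it with K(Z_n). *)

(** * Completion along an ideal whose powers stabilise *)

(* The hypotheses force I^2 = ker phi = I^N for N >= 2, so the completion is
   R/I^2, which is stage 1 of the tower. *)
Lemma completion_isomorphic (R S : psiRingType) (I : idealr R)
    (Ipsi : forall k, (0 < k)%N -> {homo psi k : x / x \in I})
    (phi : {rmorphism R -> S}) :
  (forall y, exists x, phi x = y) ->
  (forall k, (0 < k)%N -> forall x, phi (psi k x) = psi k (phi x)) ->
  {in I &, forall x y, phi (x * y) = 0} ->
  (forall N x, phi x = 0 -> x \in ideal_pow I N) ->
  exists f : {rmorphism completion I -> S}, bijective f /\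
    forall k, (0 < k)%N ->
      forall u, f (completion_psi Ipsi k u) = psi k (f u).
Proof.
move=> phi_surj phi_psi phiI2 phi_ker.
have ker2 x : x \in ideal_pow I 2 -> phi x = 0.
  move: x; apply: ideal_gen_ind => [|x y x0 y0|a _ [s [ss sI ->]]].
  - exact: rmorph0.
  - by rewrite rmorphD x0 y0 addr0.
  case: s ss sI => [|x [|y []]] // _ sI.
  rewrite !big_cons big_nil mulr1 rmorphM phiI2 ?mulr0 //; apply: sI.
    exact: mem_head.
  by rewrite !inE eqxx orbT.
pose f (u : completion I) : S := phi (repr (Defs.coord u 1)).
(* Well-definedness: [phi] kills I^2, so any representative at stage 1 computes [f]. *)
have fE u x : Defs.coord u 1 = \pi_(tower I 1) x -> f u = phi x.
  move=> E; apply/eqP; rewrite -subr_eq0 -rmorphB; apply/eqP/ker2.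
  by rewrite (Quotient.idealrBE (ideal_powS I 1)) reprK -E.
have fP u : Defs.coord u 1 = \pi_(tower I 1) (repr (Defs.coord u 1)).
  by rewrite reprK.
have fB : zmod_morphism f.
  move=> u v; rewrite -rmorphB; apply: fE.
  rewrite -[LHS]/(Defs.coord u 1 - Defs.coord v 1) {1}fP {1}(fP v).
  exact/esym/(rmorphB \pi_(tower I 1)).
have fM : monoid_morphism f.
  split.
    rewrite -(rmorph1 phi); apply: fE.
    exact/esym/(rmorph1 \pi_(tower I 1)).
  move=> u v; rewrite -rmorphM; apply: fE.
  rewrite -[LHS]/(Defs.coord u 1 * Defs.coord v 1) {1}fP {1}(fP v).
  exact/esym/(rmorphM \pi_(tower I 1)).
pose f1 := GRing.isZmodMorphism.Build _ _ f fB.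
pose f2 := GRing.isMonoidMorphism.Build _ _ f fM.
pose F : {rmorphism completion I -> S} := HB.pack f f1 f2.
exists F; split; last first.
  move=> k k0 u; rewrite -[LHS]/(f _) -[F u]/(f u) -phi_psi //.
  by apply: fE; rewrite Defs.coord_psi.
have f_inj : injective f.
  move=> u v fuv; apply: completionP => N.
  (* A representative at stage M + 1 represents [w] at all lower stages, hence at M and at 1
     simultaneously. *)
  have coord1 w M : exists2 x, Defs.coord w M = \pi_(tower I M) x & f w = phi x.
    pose x := repr (Defs.coord w (M + 1)).
    have down j K : Defs.coord w (j + K) = \pi_(tower I (j + K)) x ->
        Defs.coord w K = \pi_(tower I K) x.
      elim: j => //= j IH E; apply: IH.
      by rewrite -coordP -tower_map_pi; congr tower_map.
    have xP : Defs.coord w (M + 1) = \pi_(tower I (M + 1)) x by rewrite reprK.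
    by exists x; [apply: (down 1%N); rewrite addnC | apply/fE/(down M)].
  have [x -> fx] := coord1 u N; have [y -> fy] := coord1 v N.
  apply/eqP; rewrite -(Quotient.idealrBE (ideal_powS I N)).
  by apply: phi_ker; rewrite rmorphB -fx -fy fuv subrr.
have f_surj y : exists u, f u = y.
  have [x <-] := phi_surj y.
  exists (Completion (fun N => @tower_map_pi R I N x)); exact: fE.
have [g gK] := choice f_surj.
by exists g => // u; apply: f_inj; rewrite gK.
Qed.

(** Iterating the hypothesis gives y v = (c y)^N y v, which displays N factors from I. *)
Lemma stable_ideal_pow (R : comNzRingType) (I : idealr R) (c y v : R) N :
  y \in I -> y * v = c * y * (y * v) -> y * v \in ideal_pow I N.
Proof.
move=> yI yv.
have -> : y * v = c ^+ N * (y * v) * \prod_(z <- nseq N y) z.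
  rewrite big_nseq -[iter _ _ _]/(iter N ( *%R y) 1) iter_mulr_1.
  elim: N => [|N IH]; first by rewrite !expr0 mulr1 mul1r.
  by rewrite {1}IH {1}yv !exprS; ring.
apply/ideal_genZ/mem_ideal_gen; exists (nseq N y); split=> //.
  exact: size_nseq.
by move=> z /nseqP[->].
Qed.

(** * Derivations of the group algebra at the augmentation *)

Section Derivations.
Variables (F : fieldType) (K : zmodType) (l : {additive K -> int}).
Local Notation L := (grpalg F K).

Lemma gaugA (c : F) : gaug (c%:A : L) = c.
Proof. by rewrite gaugZ rmorph1 mulr1. Qed.

(** The derivation in direction [l] at the point where all monomials equal 1; for K = int and [l]
    the identity it is f'(1). *)
Definition gder : L -> F := linext (fun a => (l a)%:~R : F^o).

Lemma gderZ c x : gder (c *: x) = c * gder x.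
Proof. by rewrite /gder linearZ_LR. Qed.

Lemma gder_is_zmod_morphism : zmod_morphism gder.
Proof. by move=> x y; rewrite /gder raddfB. Qed.

HB.instance Definition _ :=
  GRing.isZmodMorphism.Build L F gder gder_is_zmod_morphism.

Lemma gder_mon a : gder (mon F a) = (l a)%:~R.
Proof. by rewrite /gder linext_mon. Qed.

Lemma gder1 : gder 1 = 0.
Proof. by rewrite -mon0 gder_mon raddf0. Qed.

Lemma gderA c : gder c%:A = 0.
Proof. by rewrite gderZ gder1 mulr0. Qed.

Lemma gderM x y : gder (x * y) = gder x * gaug y + gaug x * gder y.
Proof.
move: x; apply: (linear_ext (V := F^o)) => [c u v|c u v|a].
- by rewrite mulrDl -scalerAl raddfD /= gderZ.
- by rewrite !raddfD /= gderZ gaugZ /GRing.scale /=; ring.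
move: y; apply: (linear_ext (V := F^o)) => [c u v|c u v|b].
- by rewrite mulrDr -scalerAr raddfD /= gderZ.
- by rewrite !raddfD /= gderZ gaugZ /GRing.scale /=; ring.
by rewrite -monD !gder_mon !gaug_mon raddfD /= intrD mulr1 mul1r.
Qed.

Lemma gder_mul_aug0 x y : gaug x = 0 -> gaug y = 0 -> gder (x * y) = 0.
Proof. by move=> x0 y0; rewrite gderM x0 y0 mulr0 mul0r addr0. Qed.

(** This is why psi^k acts as k on first-order terms: x^a becomes x^(ka), and [l] is additive. *)
Lemma gder_adams k x : gder (gadams k x) = k%:R * gder x.
Proof.
move: x; apply: (linear_ext (V := F^o)) => [c u v|c u v|a].
- by rewrite linearP raddfD /= gderZ.
- by rewrite raddfD /= gderZ /GRing.scale /=; ring.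
by rewrite gadams_mon !gder_mon raddfMn /= rmorphMn mulr_natl.
Qed.

End Derivations.

(** * Laurent polynomials at x = 1 *)

Section LaurentPolynomials.
Variable F : fieldType.
Local Notation X := (@mon F int).

(** By linearity it suffices that x - 1 divides x^a - 1; negative exponents follow from x^(-k) - 1 =
    -x^(-k) (x^k - 1). *)
Lemma gaug_dvd (f : grpalg F int) : gaug f = 0 -> exists b, f = b * (X 1 - 1).
Proof.
pose P (f : grpalg F int) := exists b, f = (gaug f)%:A + b * (X 1 - 1).
suff: P f by move=> [b fE] f0; exists b; rewrite {1}fE f0 scale0r add0r.
have PD x y : P x -> P y -> P (x + y).
  move=> [b xE] [c yE]; exists (b + c).
  by rewrite rmorphD /= scalerDl mulrDl addrACA -xE -yE.
have PZ c x : P x -> P (c *: x).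
  move=> [b xE]; exists (c *: b).
  by rewrite gaugZ -scalerA -scalerAl -scalerDr -xE.
have Pnat (k : nat) : exists b, X k%:Z - 1 = b * (X 1 - 1).
  by have [b] := dvdX1 F k 1; rewrite -mulr_natr mul1r natz; exists b.
rewrite [f]grpalgE; elim/big_ind: _ => // [|a _].
  by exists 0; rewrite rmorph0 scale0r mul0r addr0.
apply: PZ; rewrite /P gaug_mon scale1r.
case: (intP a) => [|k|k].
- by exists 0; rewrite mul0r addr0.
- by have [b E] := Pnat k.+1; exists b; rewrite -E addrC subrK.
have [b E] := Pnat k.+1; exists (- X (- k.+1%:Z) * b).
rewrite -mulrA -E mulrBr mulr1 mulNr -monD addNr mon0 opprK.
by rewrite addrA subrr add0r.
Qed.

(* Since 1 + x + ... + x^(n-1) takes the invertible value n at x = 1, it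
   generates the unit ideal together with x - 1. *)
Lemma Xn1_factor (n : nat) : n%:R != 0 :> F ->
  exists c, (X 1 - 1) * (1 - c * (X 1 - 1)) = n%:R^-1 *: (X n%:Z - 1).
Proof.
move=> n0; pose S : grpalg F int := \sum_(i < n) X 1 ^+ i.
have SE : X n%:Z - 1 = (X 1 - 1) * S.
  by rewrite -subrX1 -monMn -mulr_natr mul1r natz.
have S1 : gaug S = n%:R.
  rewrite rmorph_sum -[n in RHS]card_ord -sumr_const; apply: eq_bigr => i _.
  by rewrite rmorphXn /= gaug_mon expr1n.
(* S / n takes the value 1 at x = 1, so S / n = 1 - b (x - 1), and this [b] serves as c. *)
have [|b bE] := @gaug_dvd (1 - n%:R^-1 *: S).
  by rewrite rmorphB rmorph1 /= gaugZ S1 mulVf // subrr.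
by exists b; rewrite -bE subKr SE scalerAr.
Qed.

End LaurentPolynomials.

(** * First-order Taylor expansions in K(Z_n) *)

Section ResolutionTaylor.
Variables (F : fieldType) (n : nat).
Local Notation L := (grpalg F {ffun 'I_n -> int}).
Local Notation Q := (resolutionK F n).
Local Notation chi := (@chi F n).

Definition ffun_eval (i : 'I_n) (a : {ffun 'I_n -> int}) : int := a i.

Lemma ffun_eval_is_zmod_morphism i : zmod_morphism (ffun_eval i).
Proof. by move=> a b; rewrite /ffun_eval !ffunE. Qed.

HB.instance Definition _ i := GRing.isZmodMorphism.Build
  {ffun 'I_n -> int} int (ffun_eval i) (ffun_eval_is_zmod_morphism i).

Definition pder i : L -> F := gder (ffun_eval i).

HB.instance Definition _ i := GRing.Additive.on (pder i).

Lemma gaug_chi i : gaug (chi i - 1) = 0.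
Proof. by rewrite rmorphB rmorph1 /= gaug_mon subrr. Qed.

Lemma pder_chi i j : pder i (chi j - 1) = (i == j)%:R.
Proof.
by rewrite raddfB /= /pder gder1 subr0 gder_mon /= /ffun_eval ffunE; case: eqP.
Qed.

Lemma pder_resolution i f : f \in @resolution_ideal F n -> pder i f = 0.
Proof.
move: f; apply: ideal_gen_ind => [|x y x0 y0|a _ [j [k ->]]].
- exact: raddf0.
- by rewrite raddfD /= x0 y0 addr0.
by rewrite mulrA /pder gder_mul_aug0 ?rmorphM /= ?gaug_chi ?mulr0.
Qed.

Lemma piD x y : \pi_Q (x + y) = \pi_Q x + \pi_Q y.
Proof. exact: (rmorphD \pi_Q). Qed.

Lemma piB x y : \pi_Q (x - y) = \pi_Q x - \pi_Q y.
Proof. exact: (rmorphB \pi_Q). Qed.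

Lemma piM x y : \pi_Q (x * y) = \pi_Q x * \pi_Q y.
Proof. exact: (rmorphM \pi_Q). Qed.

Lemma pi0 : \pi_Q 0 = 0.
Proof. exact: (rmorph0 \pi_Q). Qed.

Lemma pi1 : \pi_Q 1 = 1.
Proof. exact: (rmorph1 \pi_Q). Qed.

Lemma pi_eq0 x : \pi_Q x = 0 <-> x \in @resolution_ideal F n.
Proof.
rewrite -pi0; split=> [/eqP|x0]; last apply/eqP.
  by rewrite -Quotient.idealrBE subr0.
by rewrite -Quotient.idealrBE subr0.
Qed.

Definition tau (i : 'I_n) : Q := \pi_Q (chi i - 1).

Lemma tauM i j : tau i * tau j = 0.
Proof.
rewrite /tau -piM; apply/pi_eq0.
by apply: mem_ideal_gen; exists i, j.
Qed.

(** The structure map from F to K(Z_n); scalars act on [Q] through multiplication by its values. *)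
Definition scal (c : F) : Q := \pi_Q (c%:A).

Lemma scalE c x : \pi_Q (c *: x) = scal c * \pi_Q x.
Proof. by rewrite /scal -piM -scalerAl mul1r. Qed.

Lemma scalD c d : scal (c + d) = scal c + scal d.
Proof. by rewrite /scal scalerDl piD. Qed.

Lemma scalM c d : scal (c * d) = scal c * scal d.
Proof. by rewrite -scalE scalerA. Qed.

Lemma scal0 : scal 0 = 0.
Proof. by rewrite /scal scale0r pi0. Qed.

Lemma scal1 : scal 1 = 1.
Proof. by rewrite /scal scale1r pi1. Qed.

(* First-order Taylor expansions at chi_0 = ... = chi_{n-1} = 1. *)
Definition tay (c : F) (a : 'I_n -> F) : Q :=
  scal c + \sum_i scal (a i) * tau i.

Lemma tayE c a : tay c a = \pi_Q (c%:A + \sum_i a i *: (chi i - 1)).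
Proof.
rewrite piD (big_morph _ piD pi0); congr (_ + _).
by apply: eq_bigr => i _; rewrite scalE.
Qed.

Lemma eq_tay c a b : a =1 b -> tay c a = tay c b.
Proof. by move=> ab; congr (_ + _); apply: eq_bigr => i _; rewrite ab. Qed.

Lemma tayD c a d b : tay c a + tay d b = tay (c + d) (fun i => a i + b i).
Proof.
rewrite /tay scalD addrACA -big_split /=; congr (_ + _).
by apply: eq_bigr => i _; rewrite scalD mulrDl.
Qed.

Lemma tayB c a d b : tay c a - tay d b = tay (c - d) (fun i => a i - b i).
Proof.
apply/eqP; rewrite subr_eq tayD; apply/eqP.
rewrite -[in LHS](subrK d c); apply: eq_tay => i.
by rewrite subrK.
Qed.

(** The second-order terms vanish by the relations [tauM], so this is the product of F + V with V^2
    = 0. *)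
Lemma tayM c a d b :
  tay c a * tay d b = tay (c * d) (fun i => c * b i + a i * d).
Proof.
rewrite /tay mulrDl !mulrDr -scalM -addrA; congr (_ + _).
rewrite [X in _ + (_ + X)](_ : _ = 0) ?addr0.
  rewrite mulr_sumr mulr_suml -big_split /=; apply: eq_bigr => i _.
  by rewrite scalD !scalM; ring.
rewrite mulr_suml big1 // => i _; rewrite mulr_sumr big1 // => j _.
by rewrite mulrACA tauM mulr0.
Qed.

Lemma tay1 : tay 1 (fun=> 0) = 1.
Proof. by rewrite /tay scal1 big1 ?addr0 // => i _; rewrite /= scal0 mul0r. Qed.

Lemma tay0 : tay 0 (fun=> 0) = 0.
Proof. by rewrite /tay scal0 big1 ?addr0 // => i _; rewrite mul0r. Qed.

(** The augmentation and the partial derivatives kill the ideal, so they read the coefficients off a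
    class. *)
Lemma tay_eq0 c a : tay c a = 0 -> c = 0 /\ forall i, a i = 0.
Proof.
rewrite tayE => /pi_eq0 x0; split=> [|i].
  have := resolution_gaug x0.
  rewrite rmorphD rmorph_sum /= gaugA big1 ?addr0 //.
  by move=> i _; rewrite gaugZ gaug_chi mulr0.
have := pder_resolution i x0.
rewrite raddfD raddf_sum /= /pder gderA add0r (bigD1 i) //= big1 => [|j ij].
  by rewrite gderZ [gder _ _]pder_chi eqxx mulr1 addr0.
by rewrite gderZ [gder _ _]pder_chi eq_sym (negbTE ij) mulr0.
Qed.

(** Linearity reduces this to monomials. The exponents a for which it holds form a subgroup that
    contains those of the [chi j]. *)
Lemma pi_tay x : \pi_Q x = tay (gaug x) (fun i => pder i x).
Proof.
pose P x := \pi_Q x = tay (gaug x) (fun i => pder i x).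
have PD y z : P y -> P z -> P (y + z).
  rewrite /P piD => -> ->; rewrite tayD rmorphD; apply: eq_tay => i.
  by rewrite raddfD.
have PZ c y : P y -> P (c *: y).
  rewrite /P scalE => ->; rewrite gaugZ /tay scalM mulrDr mulr_sumr.
  by congr (_ + _); apply: eq_bigr => i _; rewrite /pder gderZ scalM mulrA.
pose M (a : {ffun 'I_n -> int}) := \pi_Q (mon F a) = tay 1 (fun i => (a i)%:~R).
have MD a b : M a -> M b -> M (a + b).
  rewrite /M monD piM => -> ->; rewrite tayM mulr1; apply: eq_tay => i.
  by rewrite ffunE intrD mulr1 mul1r addrC.
(* The expansion [t] is inverse to the class of x^a, and inverses are unique. *)
have MN a : M a -> M (- a).
  rewrite /M => Ma; set t := tay _ _.
  have T1 : \pi_Q (mon F a) * t = 1.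
    rewrite Ma tayM mulr1 -tay1; apply: eq_tay => i.
    by rewrite ffunE mulrNz mulr1 mul1r addNr.
  transitivity (\pi_Q (mon F (- a)) * (\pi_Q (mon F a) * t)).
    by rewrite T1 mulr1.
  by rewrite mulrA -piM -monD addNr mon0 pi1 mul1r.
have M0 : M 0.
  by rewrite /M mon0 pi1 -tay1; apply: eq_tay => i; rewrite ffunE.
have Mchi j : M [ffun i => (i == j)%:Z].
  rewrite /M /tay scal1 (bigD1 j) //= big1 => [|i ij].
    by rewrite ffunE eqxx scal1 mul1r addr0 /tau piB pi1 addrC subrK.
  by rewrite ffunE (negbTE ij) scal0 mul0r.
have Mz j z : M [ffun i => (i == j)%:Z * z].
  elim/int_rect: z => [|k Mk|k Mk].
  - rewrite (_ : [ffun _ => _] = 0) //.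
    by apply/ffunP => i; rewrite !ffunE mulr0.
  - have := MD _ _ (Mchi j) Mk; congr M.
    by apply/ffunP => i; rewrite !ffunE intS mulrDr mulr1.
  have := MD _ _ (MN _ (Mchi j)) Mk; congr M.
  by apply/ffunP => i; rewrite !ffunE intS opprD mulrDr mulrN1.
have Ma a : M a.
  have -> : a = \sum_j [ffun i => (i == j)%:Z * a j].
    apply/ffunP => i; rewrite sum_ffunE (bigD1 i) //= ffunE eqxx mul1r.
    rewrite big1 ?addr0 // => j /negbTE ji.
    by rewrite ffunE eq_sym ji mul0r.
  by elim/big_ind: _ => // j _; exact: Mz.
rewrite -/(P x) [x]grpalgE; elim/big_ind: _ => // [|a _].
  rewrite /P pi0 rmorph0 -tay0; apply: eq_tay => i.
  by rewrite raddf0.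
apply: PZ; rewrite /P gaug_mon [LHS]Ma; apply: eq_tay => i.
by rewrite /pder gder_mon.
Qed.

Lemma psi_tay k c a : (0 < k)%N ->
  psi k (tay c a) = tay c (fun i => k%:R * a i).
Proof.
move=> k0; rewrite {1}tayE; set x : L := c%:A + _.
transitivity (\pi_Q (gadams k x)).
  exact: (quot_psi_pi (@resolution_ideal_psi F n) x k0).
(* Uniqueness of expansions identifies c and a with the coefficients of the lift [x]. *)
have : tay c a - tay (gaug x) (fun i => pder i x) = 0.
  by rewrite -pi_tay tayE subrr.
rewrite tayB => /tay_eq0[/subr0_eq -> aE].
rewrite pi_tay gaug_adams; apply: eq_tay => i.
by rewrite /pder gder_adams (subr0_eq (aE i)).
Qed.

End ResolutionTaylor.

(** * The comparison map from virtual K-theory to K(Z_n) *)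

Section Comparison.
Variables (F : fieldType) (n' : nat).
Local Notation n := n'.+2.
Hypothesis n_neq0 : n%:R != 0 :> F.
Local Notation L := (grpalg F int).
Local Notation X := (@mon F int).
Local Notation K := (virtualK F n).
Local Notation I := (Idealr.clone K (@vaug_ker F n) _ : idealr K).
Local Notation Q := (resolutionK F n).

Definition xder : L -> F := gder (idfun : {additive int -> int}).

HB.instance Definition _ := GRing.Additive.on xder.

(** The relation of sector 0 vanishes to second order at x = 1, so f_0'(1) is well defined there; in
    the other sectors only the value is. *)
Definition vcoef (m : 'Z_n) : L -> F := if m == 0 then xder else @gaug F int.

Lemma vcoef_is_zmod_morphism m : zmod_morphism (vcoef m).
Proof. by move=> x y; rewrite /vcoef; case: ifP; rewrite raddfB. Qed.

HB.instance Definition _ m := GRing.isZmodMorphism.Build L F (vcoef m)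
  (vcoef_is_zmod_morphism m).

Lemma gaugX1 a : gaug (X a - 1) = 0.
Proof. by rewrite rmorphB rmorph1 /= gaug_mon subrr. Qed.

Lemma vcoef_sector m x : x \in sector_ideal m -> vcoef m x = 0.
Proof.
move=> xm; rewrite /vcoef; case: ifP => [/eqP m0|_]; last exact: gaug_sector xm.
case/sector_idealP: xm => a ->; rewrite m0 /sector_rel eqxx mulrA.
by rewrite /xder gder_mul_aug0 ?rmorphM /= ?gaugX1 ?mulr0.
Qed.

(* The index types 'Z_n and 'I_n coincide here, since n is n'.+2. *)
Definition lift_comparison (f : 'Z_n -> L) : Q :=
  tay (gaug (f 0)) (fun m => vcoef m (f m)).

Definition comparison (u : K) : Q := lift_comparison (vrep u).

Lemma comparison_class f : comparison (vclass f) = lift_comparison f.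
Proof.
have E := vrep_class f; apply/eqP; rewrite -subr_eq0 tayB.
have -> : gaug (vrep (vclass f) 0) - gaug (f 0) = 0.
  by rewrite -rmorphB; exact: gaug_sector (E 0).
rewrite -tay0; apply/eqP/eq_tay => m.
by rewrite -raddfB; exact: vcoef_sector (E m).
Qed.

(** The class [euler] vanishes at x = 1 unless one index is 0, so only the summands of index 0 and m
    survive. *)
Lemma gaug_lift_mul (f g : 'Z_n -> L) m :
  gaug (lift_mul f g m) =
  if m == 0 then gaug (f 0) * gaug (g 0)
  else gaug (f 0) * gaug (g m) + gaug (f m) * gaug (g 0).
Proof.
rewrite /lift_mul raddf_sum (bigD1 0) //= subr0.
rewrite !rmorphM /= gaug_euler eqxx mulr1.
case: ifP => [/eqP -> | m0].
  rewrite big1 ?addr0 // => a a0.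
  by rewrite !rmorphM /= gaug_euler sub0r oppr_eq0 (negbTE a0) mulr0.
congr (_ + _); rewrite (bigD1 m) ?m0 //= subrr !rmorphM /= gaug_euler eqxx.
rewrite orbT mulr1 big1 ?addr0 // => a /andP[a0 am].
rewrite !rmorphM /= gaug_euler (negbTE a0) subr_eq0 eq_sym (negbTE am).
by rewrite mulr0.
Qed.

(** For m = 0, products of two twisted sectors carry (1 - x^(-1))^2, whose derivative at 1 is 0;
    what remains is the Leibniz rule. *)
Lemma vcoef_lift_mul (f g : 'Z_n -> L) m : vcoef m (lift_mul f g m) =
  gaug (f 0) * vcoef m (g m) + vcoef m (f m) * gaug (g 0).
Proof.
rewrite /vcoef; have [-> | m0] := eqVneq m 0; last first.
  by rewrite gaug_lift_mul (negbTE m0).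
rewrite /lift_mul raddf_sum (bigD1 0) //= subr0 big1 => [|a a0].
  by rewrite addr0 /euler eqxx mulr1 /xder gderM addrC.
rewrite sub0r /euler oppr_eq0 (negbTE a0) subrr eqxx /= expr2 mulrA /xder.
have e0 : gaug (1 - X (-1)) = 0 by rewrite rmorphB rmorph1 /= gaug_mon subrr.
by rewrite gder_mul_aug0 ?rmorphM /= ?e0 ?mulr0.
Qed.

Lemma comparison_is_zmod_morphism : zmod_morphism comparison.
Proof.
elim/virtualK_ind=> f; elim/virtualK_ind=> g.
rewrite vclassB !comparison_class tayB /lift_comparison raddfB.
apply: eq_tay => m /=.
exact: raddfB.
Qed.

Lemma comparison_is_monoid_morphism : monoid_morphism comparison.
Proof.
split.
  rewrite -[1]/(vclass (lift_one F (n := n))) comparison_class /lift_comparison.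
  rewrite {1}/lift_one eqxx rmorph1 -tay1; apply: eq_tay => m.
  rewrite /vcoef /lift_one; case: eqVneq => _; last by rewrite rmorph0.
  by rewrite /xder gder1.
elim/virtualK_ind=> f; elim/virtualK_ind=> g.
rewrite vclassM !comparison_class tayM /lift_comparison gaug_lift_mul eqxx.
by apply: eq_tay => m; exact: vcoef_lift_mul.
Qed.

HB.instance Definition _ := GRing.isZmodMorphism.Build K Q comparison
  comparison_is_zmod_morphism.
HB.instance Definition _ := GRing.isMonoidMorphism.Build K Q comparison
  comparison_is_monoid_morphism.

Lemma comparison_surj y : exists u, comparison u = y.
Proof.
pose x := repr y; have <- : \pi_Q x = y by rewrite reprK.
(* The simplest preimage: a linear polynomial in x - 1 with prescribed value and derivative in
   sector 0, constants elsewhere. *)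
pose f (m : 'Z_n) : L := if m == 0
  then (gaug x)%:A + pder m x *: (X 1 - 1) else (pder m x)%:A.
exists (vclass f); rewrite comparison_class pi_tay /lift_comparison.
have -> : gaug (f 0) = gaug x.
  by rewrite /f eqxx rmorphD /= gaugA gaugZ gaugX1 mulr0 addr0.
apply: eq_tay => m; rewrite /vcoef /f; case: eqVneq => _; last by rewrite gaugA.
rewrite raddfD /= /xder gderA gderZ raddfB /= gder1 gder_mon /=.
by rewrite add0r subr0 mulr1.
Qed.

(** The factor [theta] makes psi^k act as k on the values in twisted sectors, matching its action on
    the derivative in sector 0. *)
Lemma gaug_theta k : gaug (theta F k) = k%:R.
Proof.
rewrite rmorph_sum -[k in RHS]card_ord -sumr_const; apply: eq_bigr => i _.
by rewrite /= gaug_mon.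
Qed.

Lemma comparison_psi k : (0 < k)%N ->
  forall u, comparison (psi k u) = psi k (comparison u).
Proof.
move=> k0; elim/virtualK_ind=> f; rewrite [psi _ _]vpsi_class !comparison_class.
rewrite psi_tay // /lift_comparison {1}/lift_psi eqxx gaug_adams.
apply: eq_tay => m; rewrite /vcoef /lift_psi.
case: eqVneq => _; first by rewrite /xder gder_adams.
by rewrite rmorphM /= gaug_adams gaug_theta mulrC.
Qed.

Lemma mem_vaug_ker f : vclass f \in I <-> gaug (f 0) = 0.
Proof.
rewrite -topredE /= /vaug_ker vaug_class; split=> [/eqP/vclass_eq/(_ 0)|f0].
  by rewrite subr0 /lift_aug eqxx => /gaug_sector; rewrite gaugA.
apply/eqP/vclass_eq => m.
by rewrite subr0 /lift_aug f0 scale0r if_same ideal_gen0.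
Qed.

Lemma comparison_vaug_ker2 : {in I &, forall u v, comparison (u * v) = 0}.
Proof.
elim/virtualK_ind=> f; elim/virtualK_ind=> g /mem_vaug_ker f0 /mem_vaug_ker g0.
rewrite rmorphM /= !comparison_class tayM f0 g0 mulr0 -tay0.
by apply: eq_tay => m; rewrite mul0r mulr0 addr0.
Qed.

Lemma comparison_ker N u : comparison u = 0 -> u \in ideal_pow I N.
Proof.
elim/virtualK_ind: u => f; rewrite comparison_class => /tay_eq0[f0 fm].
have [c cE] := Xn1_factor n_neq0.
pose y : K := vsec 0 (X 1 - 1); pose c0 : K := vsec 0 c.
have yI : y \in I by apply/mem_vaug_ker; rewrite eqxx gaugX1.
(* By the choice of c, (1 - c y) y is (x^n - 1) / n. This is zero in a twisted sector; in sector 0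
   the factor x - 1 of [g] completes the relation. *)
have stab m g : (m == 0 -> exists b, g = b * (X 1 - 1)) ->
    y * vsec m g = c0 * y * (y * vsec m g).
  move=> gm; apply/eqP; rewrite -subr_eq0 -{1}[y]mul1r -mulrA -mulrBl.
  rewrite -vsec_one !vsecM /euler !eqxx /= !add0r !mulr1.
  rewrite [vsec 0 1 - _](_ : _ = vsec 0 (1 - c * (X 1 - 1))); last first.
    rewrite vclassB; congr vclass; apply: funext => m'.
    by case: eqP; rewrite ?subr0.
  rewrite vsecM /euler eqxx add0r mulr1 mulrA [_ * (X 1 - 1)]mulrC cE.
  apply/eqP/vclass_eq => m'; rewrite subr0.
  case: eqVneq => [->|_]; last exact: ideal_gen0.
  apply/sector_idealP; rewrite /sector_rel; case: ifP => [/gm [b ->]|_].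
    by exists (n%:R^-1 *: b); rewrite -!scalerAl; congr (_ *: _); ring.
  by exists (n%:R^-1 *: g); rewrite -!scalerAl mulrC.
rewrite vclass_sum; elim/big_ind: _ => [|u v|m _].
- exact: ideal_gen0.
- exact: ideal_genD.
suff [g gm ->] : exists2 g, (m == 0 -> exists b, g = b * (X 1 - 1)) &
    vsec m (f m) = y * vsec m g.
  by apply: stable_ideal_pow (stab _ _ gm).
have yg g : y * vsec m g = vsec m (g * (X 1 - 1)).
  by rewrite vsecM /euler eqxx add0r mulr1 mulrC.
have := fm m; rewrite /vcoef; have [->|m0] := eqVneq m 0; last first.
  by move=> /gaug_dvd[b ->]; exists b; rewrite ?yg.
(* In sector 0, f_0 = b (x - 1) has derivative b(1) at x = 1; this is 0, so x - 1 divides [b] as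
   well. *)
have [b bE] := gaug_dvd f0; rewrite bE /xder gderM gaugX1 mulr0 add0r.
rewrite raddfB /= gder1 gder_mon /= subr0 mulr1 => /gaug_dvd[d dE].
by exists b; [exists d | rewrite vsecM /euler eqxx add0r mulr1 mulrC].
Qed.

Lemma virtualK_hat_resolutionK :
  psi_isomorphic (virtualK_hat F n) (resolutionK F n).
Proof.
have [f fP] := completion_isomorphic (@vaug_ker_psi F n)
  (phi := comparison) comparison_surj comparison_psi comparison_vaug_ker2
  comparison_ker.
by exists f.
Qed.

End Comparison.

Theorem theorem8p2 (R : realType) (n : nat) (hn : (2 <= n)%N) :
  psi_isomorphic (virtualK_hat R[i] n) (resolutionK R[i] n).
Proof.
case: n hn => [|[|n]] // _; apply: virtualK_hat_resolutionK.
by rewrite pnatr_eq0.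
Qed.
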